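(* Let $p>1$, $q>1$ with $p^{-1}+q^{-1}>1$. There exists a constant $C_{p,q}<+\infty$, depending on $p$ and $q$ only, such that the following holds. Let $E,V$ be Banach spaces, $a<b$ real numbers, and let $f:[a,b]\to L(E,V)$, $g:[a,b]\to E$ be two functions with no common points of discontinuity such that $f\in\mathcal{V}^{p}([a,b],L(E,V))$ and $g\in\mathcal{V}^{q}([a,b],E)$. Then the Riemann-Stieltjes integral $\int_{a}^{b}f\,\mathrm{d}g$ exists, and $$\left\|\int_{a}^{b}f\,\mathrm{d}g-f(a)[g(b)-g(a)]\right\|_{V}\le C_{p,q}\,\|f\|_{p\text{-var},[a,b]}^{p-p/q}\,\|f\|_{\mathrm{osc},[a,b]}^{1+p/q-p}\,\|g\|_{q\text{-var},[a,b]}.$$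
   Context: $L(E,V)$ is the Banach space of continuous linear maps $E\to V$ with the operator norm. For a Banach space $W$, $p\ge 1$ and $h:[a,b]\to W$, the $p$-variation is $$V^{p}(h,[a,b]):=\sup_{n}\ \sup_{a\le t_{0}<t_{1}<\ldots<t_{n}\le b}\ \sum_{i=1}^{n}\|h(t_{i})-h(t_{i-1})\|_{W}^{p},$$ $\mathcal{V}^{p}([a,b],W)$ is the set of $h:[a,b]\to W$ with $V^{p}(h,[a,b])<+\infty$, $\|h\|_{p\text{-var},[a,b]}:=(V^{p}(h,[a,b]))^{1/p}$, and $\|h\|_{\mathrm{osc},[a,b]}:=\sup_{a\le s<t\le b}\|h(s)-h(t)\|_{W}$. $f(\xi)[g(t)-g(s)]\in V$ denotes the value of the linear map $f(\xi)$ at the vector $g(t)-g(s)$. The Riemann-Stieltjes integral $\int_a^b f\,\mathrm{d}g\in V$ is the common limit (if it exists) of the sums $\sum_{i}f(\xi_{i})[g(t_{i})-g(t_{i-1})]$ over all sequences of tagged partitions $a=t_0<t_1<\dots<t_n=b$, $\xi_i\in[t_{i-1},t_i]$, with mesh $\max_i(t_i-t_{i-1})$ tending to $0$. *)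

(* Defs.v *)
From HB Require Import structures.
From mathcomp Require Import all_boot all_order all_algebra.
From mathcomp Require Import all_classical all_reals all_analysis.

Set Implicit Arguments.
Unset Strict Implicit.
Unset Printing Implicit Defensive.

Import Order.TTheory GRing.Theory Num.Theory.
Import numFieldNormedType.Exports.

Local Open Scope classical_set_scope.
Local Open Scope ring_scope.

Section continuous_linear_maps.
Context {R : realType} {E V : normedModType R}.

Definition clin_pred : {pred E -> V} :=
  [pred h : E -> V | `[< linear h /\ continuous h >]].

Record clin := CLin { clin_fun :> E -> V ; _ : clin_fun \in clin_pred }.

HB.instance Definition _ := [isSub for clin_fun].
HB.instance Definition _ := [Choice of clin by <:].

Lemma clin_linear (h : clin) : linear h.
Proof. by have /asboolP[] := valP h. Qed.

Lemma clin_continuous (h : clin) : continuous h.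
Proof. by have /asboolP[] := valP h. Qed.

HB.instance Definition _ (h : clin) :=
  GRing.isLinear.Build R E V *:%R h (@clin_linear h).

Lemma clin_submod_closed : submod_closed clin_pred.
Proof.
split=> [|k g h /asboolP[lg cg] /asboolP[lh ch]]; apply/asboolP; split.
- by move=> k x y; rewrite /= scaler0 addr0.
- by move=> x; exact: cvg_cst.
- move=> l x y; rewrite !fctE lg lh !scalerDr !scalerA (mulrC k l).
  exact: addrACA.
- by move=> x; apply: cvgD; [apply: cvgZl_tmp; exact: cg | exact: ch].
Qed.

HB.instance Definition _ :=
  GRing.isSubmodClosed.Build R (E -> V) clin_pred clin_submod_closed.
HB.instance Definition _ := [SubChoice_isSubLmodule of clin by <:].

Definition opnorm (h : clin) : R := sup [set `|h x| | x in [set x | `|x| <= 1]].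

Lemma opnorm_has_sup (h : clin) :
  has_sup [set `|h x| | x in [set x | `|x| <= 1]].
Proof.
split; first by exists `|h 0|, 0 => //=; rewrite normr0.
have /linear_boundedP/pinfty_ex_gt0[M M0 hM] : bounded_near h (nbhs 0).
  exact/linear_bounded_continuous/clin_continuous.
exists M => _ [x /= x1 <-].
by rewrite (le_trans (hM x))// ler_piMr// ltW.
Qed.

Lemma opnorm_ub (h : clin) (x : E) : `|x| <= 1 -> `|h x| <= opnorm h.
Proof. by move=> x1; apply: ub_le_sup; [case: (opnorm_has_sup h) | exists x]. Qed.

Lemma opnorm_le (h : clin) (M : R) :
  (forall x, `|x| <= 1 -> `|h x| <= M) -> opnorm h <= M.
Proof.
move=> hM; apply: ge_sup; first by case: (opnorm_has_sup h).
by move=> _ [x /= x1 <-]; exact: hM.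
Qed.

Lemma opnorm_ge0 (h : clin) : 0 <= opnorm h.
Proof. by rewrite (le_trans _ (@opnorm_ub h 0 _))// normr0. Qed.

Lemma ler_opnorm (h : clin) (x : E) : `|h x| <= opnorm h * `|x|.
Proof.
have [->|x0] := eqVneq x 0; first by rewrite linear0 !normr0 mulr0.
have nx : 0 < `|x| by rewrite normr_gt0.
rewrite -ler_pdivrMr//.
have := @opnorm_ub h (`|x|^-1 *: x).
rewrite linearZ/= !normrZ ger0_norm ?invr_ge0// mulVf ?gt_eqF//.
by rewrite mulrC; apply.
Qed.

Lemma opnormD (g h : clin) : opnorm (g + h) <= opnorm g + opnorm h.
Proof.
apply: opnorm_le => x x1.
by rewrite (le_trans (ler_normD _ _))// lerD// opnorm_ub.
Qed.

Lemma opnormZ (k : R) (h : clin) : opnorm (k *: h) = `|k| * opnorm h.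
Proof.
have le l (g : clin) : opnorm (l *: g) <= `|l| * opnorm g.
  apply: opnorm_le => x x1.
  by rewrite [leLHS]normrZ ler_wpM2l// opnorm_ub.
have [->|k0] := eqVneq k 0.
  apply/eqP; rewrite normr0 mul0r eq_le opnorm_ge0 andbT.
  by rewrite (le_trans (le _ _))// normr0 mul0r.
apply/eqP; rewrite eq_le le/= -ler_pdivlMl ?normr_gt0//.
by rewrite -normfV (le_trans _ (le _ _))// scalerA mulVf// scale1r.
Qed.

Lemma opnorm0_eq0 (h : clin) : opnorm h = 0 -> h = 0.
Proof.
move=> h0; apply/val_inj/funext => x /=; apply/eqP.
by rewrite -normr_le0 (le_trans (ler_opnorm h x))// h0 mul0r.
Qed.

HB.instance Definition _ :=
  Lmodule_isNormed.Build R clin opnormD opnormZ opnorm0_eq0.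

End continuous_linear_maps.
Arguments clin {R} E V.

Section p_variation.
Context {R : realType} {W : normedModType R}.
Implicit Types (p a b c d : R) (h : R -> W) (s : seq R).

(* The points are t_0 = c and t_i = s`_(i-1) for 1 <= i <= size s. *)
Definition pvariation_sum p h c s : R :=
  \sum_(i < size s) `|h (nth c (c :: s) i.+1) - h (nth c (c :: s) i)| `^ p.

(* The partitions run over [c, d] for arbitrary a <= c <= d <= b: the extreme
   points t_0 and t_n need not be a and b. *)
Definition pvariation p h a b : \bar R :=
  ereal_sup [set v | exists c d s,
    [/\ a <= c, itv_partition c d s, d <= b & v = (pvariation_sum p h c s)%:E]].

Definition finite_pvariation p h a b : Prop := (pvariation p h a b < +oo)%E.

Definition pvar_norm p h a b : \bar R := (pvariation p h a b `^ p^-1)%E.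

Definition osc_norm h a b : \bar R :=
  ereal_sup [set v | exists x y,
    [/\ a <= x, x < y, y <= b & v = `|h x - h y|%:E]].

(* Continuity at x of the restriction of h to [a, b]. *)
Definition continuous_in_at a b h (x : R) : Prop :=
  h @ within `[a, b] (nbhs x) --> h x.

End p_variation.

Section riemann_stieltjes.
Context {R : realType}.

(* The points are t_0 = a and t_i = (tp_pts P)`_(i-1) for
   1 <= i <= n = size (tp_pts P), with t_n = b; the tag of [t_i, t_(i+1)]
   is tp_tag P i. *)
Record tagged_partition (a b : R) := TaggedPartition {
  tp_pts : seq R ;
  tp_tag : nat -> R ;
  _ : itv_partition a b tp_pts ;
  _ : forall i, (i < size tp_pts)%N ->
        nth a (a :: tp_pts) i <= tp_tag i <= nth a (a :: tp_pts) i.+1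
}.

Definition tp_mesh (a b : R) (P : tagged_partition a b) : R :=
  \big[Num.max/0]_(i < size (tp_pts P))
    (nth a (a :: tp_pts P) i.+1 - nth a (a :: tp_pts P) i).

Context {E V : normedModType R}.

Definition RS_sum (f : R -> clin E V) (g : R -> E) (a b : R)
    (P : tagged_partition a b) : V :=
  \sum_(i < size (tp_pts P))
    f (tp_tag P i)
      (g (nth a (a :: tp_pts P) i.+1) - g (nth a (a :: tp_pts P) i)).

Definition is_RS_integral (f : R -> clin E V) (g : R -> E) (a b : R) (I : V) :
    Prop :=
  forall P : nat -> tagged_partition a b,
    tp_mesh (P n) @[n --> \oo] --> (0 : R) ->
    RS_sum f g (P n) @[n --> \oo] --> I.

End riemann_stieltjes.

(* Main.v *)
(* Removing from a tagged partition with n intervals the k-th tag xi_k together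
   with the point t_(k-1) changes the Riemann sum by
   (f(xi_k) - f(xi_(k-1)))[g(t_k) - g(t_(k-1))].  By pigeonhole k can be chosen
   so that this is at most
   min(osc f, (2 V^p(f) / n)^(1/p)) * (2 V^q(g) / n)^(1/q).  Summing over n, and
   cutting the sum at n = V^p(f) / (osc f)^p, gives the stated bound with a
   constant depending on p and q only.

   For existence, the same estimate is used on each interval of a fine partition
   with the product |df| |dg| bounded by a power of the modulus
   sup |f x - f x'| |g y - g y'| over short intervals, which tends to 0 by
   compactness since f and g have no common discontinuity.  As
   1/p + 1/q > 1, the local errors are controlled by the increments of a
   monotone function, so they sum up to something small: Riemann sums are Cauchy
   as the mesh tends to 0. *)
Require Import Defs.
From HB Require Import structures.
From mathcomp Require Import all_boot all_order all_algebra.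
From mathcomp Require Import all_classical all_reals all_analysis.
From mathcomp Require Import ring lra.

Set Implicit Arguments.
Unset Strict Implicit.
Unset Printing Implicit Defensive.

Import Order.TTheory GRing.Theory Num.Theory.
Import numFieldNormedType.Exports.

Local Open Scope classical_set_scope.
Local Open Scope ring_scope.

(** * Sums of inverse powers, bounded by telescoping *)

Section power_sums.
Context {R : realType}.
Implicit Types (r s : R) (m n k : nat).

(** Young's inequality for the product of [(1 - x) ^ r] and 1, with conjugate exponents [1 / r] and
    [1 / (1 - r)]. *)
Lemma powR_bernoulli_le r (x : R) : 0 < r < 1 -> 0 <= x <= 1 ->
  (1 - x) `^ r <= 1 - r * x.
Proof.
move=> /andP[r0 r1] /andP[x0 x1].
have x10 : 0 <= 1 - x by rewrite subr_ge0.
have := @conjugate_powR R ((1 - x) `^ r) 1 r^-1 (1 - r)^-1.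
rewrite powR_ge0 ler01 !invr_gt0 r0 subr_gt0 r1 !invrK addrC subrK.
move=> /(_ isT isT isT isT erefl).
rewrite mulr1 -powRrM mulfV ?gt_eqF// powRr1// powR1 mul1r => /le_trans; apply.
lra.
Qed.

(** Bernoulli with exponent [1 - r] at [x = 1 / (m + 1)], multiplied by [(m + 1) ^ (1 - r)]; this
    stands in for comparison with an integral. *)
Lemma powRN_telescope_lt1 r m : 0 < r < 1 ->
  m.+1%:R `^ (- r) * (1 - r) <= m.+1%:R `^ (1 - r) - m%:R `^ (1 - r) :> R.
Proof.
move=> /andP[r0 r1].
have m0 : 0 < m.+1%:R :> R by rewrite ltr0n.
have := @powR_bernoulli_le (1 - r) m.+1%:R^-1.
have -> : 0 < 1 - r < 1 by apply/andP; split; lra.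
rewrite invr_ge0 ltW//= invf_le1// ler1n => /(_ isT isT).
have -> : 1 - m.+1%:R^-1 = m%:R / m.+1%:R :> R.
  by rewrite -natr1; field; rewrite natr1 gt_eqF.
rewrite powRM// ?invr_ge0// -powR_inv1// -powRrM mulN1r => H.
have /(ler_wpM2l (powR_ge0 m.+1%:R (1 - r))) := H.
rewrite mulrCA -powRD; last by rewrite (gt_eqF m0) implybT.
rewrite subrr powRr0 mulr1 mulrBr mulr1 mulrCA -powRD; last first.
  by rewrite (gt_eqF m0) implybT.
have -> : 1 - r - 1 = - r by ring.
lra.
Qed.

(** Convexity again, through [1 + y <= exp y] and [ln (1 + x) <= x] at [x = - 1 / (m + 1)]. *)
Lemma powRN_telescope_gt1 s m : 1 < s -> (0 < m)%N ->
  m.+1%:R `^ (- s) * (s - 1) <= m%:R `^ (1 - s) - m.+1%:R `^ (1 - s) :> R.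
Proof.
move=> s1 m0; have m0' : 0 < m%:R :> R by rewrite ltr0n.
have M0 : 0 < m.+1%:R :> R by rewrite ltr0n.
have : 1 + (s - 1) / m.+1%:R <= (m%:R / m.+1%:R) `^ (1 - s) :> R.
  rewrite /powR gt_eqF ?divr_gt0//.
  apply: le_trans (expR_ge1Dx _); rewrite lerD2l.
  rewrite -[leRHS]mulrNN opprB ler_pM2l ?subr_gt0//.
  have := @le_ln1Dx R (- m.+1%:R^-1).
  have -> : 1 - m.+1%:R^-1 = m%:R / m.+1%:R :> R.
    by rewrite -natr1; field; rewrite natr1 gt_eqF.
  rewrite ltrN2 invf_lt1// ltr1n ltnS => /(_ m0) lnN; rewrite lerNr; exact: lnN.
move/(ler_wpM2l (powR_ge0 m.+1%:R (1 - s))).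
rewrite -powRM ?divr_ge0// mulrCA divff ?gt_eqF// mulr1 mulrDr mulr1.
rewrite mulrCA -powR_inv1// -powRD; last by rewrite (gt_eqF M0) implybT.
have -> : 1 - s - 1 = - s by ring.
lra.
Qed.

Lemma ler_sum_powRN_lt1 r n : 0 < r < 1 ->
  \sum_(0 <= m < n) m.+1%:R `^ (- r) <= n%:R `^ (1 - r) / (1 - r) :> R.
Proof.
move=> r01; have r1 : 0 < 1 - r by move: r01 => /andP[]; lra.
rewrite ler_pdivlMr// mulr_suml.
rewrite (le_trans (ler_sum _ (fun m _ => @powRN_telescope_lt1 r m r01)))//.
by rewrite telescope_sumr// powR0 ?subr0// gt_eqF.
Qed.

Lemma ler_sum_powRN_gt1 s k n : 1 < s -> (0 < k)%N ->
  \sum_(k <= m < n) m.+1%:R `^ (- s) <= k%:R `^ (1 - s) / (s - 1) :> R.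
Proof.
move=> s1 k0; have s10 : 0 < s - 1 by rewrite subr_gt0.
have [nk|kn] := leqP n k; first by rewrite big_geq// divr_ge0 ?powR_ge0// ltW.
rewrite ler_pdivlMr// mulr_suml.
rewrite (@le_trans _ _ (\sum_(k <= m < n) (m%:R `^ (1 - s) - m.+1%:R `^ (1 - s))))//.
  rewrite big_nat [leRHS]big_nat; apply: ler_sum => m /andP[km _].
  by apply: powRN_telescope_gt1 => //; exact: leq_trans km.
rewrite -[X in X <= _]opprK -sumrN.
under eq_bigr do rewrite opprB.
by rewrite telescope_sumr ?(ltnW kn)// opprB gerBl powR_ge0.
Qed.

End power_sums.

(** * Pigeonhole, and the effect of removing one point from a sum *)

Lemma sum_le_exists_le {R : realFieldType} n (F : nat -> R) (X : R) :
  \sum_(i < n.+1) F i <= X -> exists2 k, (k <= n)%N & F k <= X / n.+1%:R.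
Proof.
move=> FX; have [[k kn]|H] := pselect (exists2 k, (k <= n)%N & F k <= X / n.+1%:R).
  by exists k.
have : \sum_(i < n.+1) (X / n.+1%:R) < \sum_(i < n.+1) F i.
  apply: ltr_sum => [|i _]; first by apply/hasP; exists ord0 => //; rewrite mem_index_enum.
  by rewrite ltNge; apply/negP => Fi; apply: H; exists (nat_of_ord i); rewrite ?Fi// -ltnS.
rewrite sumr_const card_ord -[ltLHS]mulr_natr divfK ?pnatr_eq0//.
by rewrite ltNge FX.
Qed.

(* B stands for the evaluation pairing of L(E, V) with E; keeping it abstract
   also prevents (x - y : clin E V) from simplifying to a difference of
   functions. *)
Section point_removal.
Context {X Y V : zmodType} (B : X -> Y -> V).
Context (BDl : forall x x' y, B (x + x') y = B x y + B x' y).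
Context (BDr : forall x y y', B x (y + y') = B x y + B x y').

(** [x i.+1] is the tag between [y i] and [y i.+1], and [x 0] is a base value: this is a Riemann sum
    minus the pairing of [x 0] with [y n - y 0]. *)
Definition tag_error n (x : nat -> X) (y : nat -> Y) : V :=
  \sum_(0 <= i < n) B (x i.+1 - x 0) (y i.+1 - y i).

(** Once [y k] and [x k.+1] are dropped, the tag [x k] covers the merged interval up to [y k.+1].
    For [k = 0] the first interval just disappears, as the base tag contributes 0. *)
Lemma tag_error_remove n k x y : (k <= n)%N ->
  tag_error n.+1 x y =
  tag_error n (x \o bump k.+1) (y \o bump k) +
    B (x k.+1 - x k) (y k.+1 - y k).
Proof.
have B0l z : B 0 z = 0 by apply/(addrI (B 0 z)); rewrite -BDl !addr0.
have lo h i : (i < h)%N -> bump h i = i by rewrite /bump ltnNge => /negbTE->.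
have hi h i : (h <= i)%N -> bump h i = i.+1 by rewrite /bump => ->.
move=> kn; rewrite /tag_error /= lo//.
rewrite (big_cat_nat (n := k))//=; last exact: leqW.
rewrite [in RHS](big_cat_nat (n := k))//= [X in _ + X = _]big_ltn ?ltnS//.
have -> : \sum_(k <= i < n)
    B (x (bump k.+1 i.+1) - x 0) (y (bump k i.+1) - y (bump k i)) =
  \sum_(k.+1 <= i < n.+1) B (x i.+1 - x 0) (y i.+1 - y i).
  rewrite big_add1 /=; apply: eq_big_nat => i /andP[ki _].
  by rewrite !hi// leqW.
have -> : \sum_(0 <= i < k)
    B (x (bump k.+1 i.+1) - x 0) (y (bump k i.+1) - y (bump k i)) =
  \sum_(0 <= i < k) B (x i.+1 - x 0) (y i.+1 - y i) +
    B (x k - x 0) (y k.+1 - y k).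
  case: k kn => [|k] kn; first by rewrite !big_geq// subrr B0l add0r.
  rewrite !big_nat_recr//= -addrA; congr (_ + _).
    apply: eq_big_nat => i /andP[_ ik].
    by rewrite !lo// ltnS ltnW.
  rewrite lo// hi// lo//.
  by rewrite -BDr; congr (B _ _); rewrite [RHS]addrC subrKA.
have -> : x k.+1 - x 0 = (x k - x 0) + (x k.+1 - x k) by rewrite [RHS]addrC subrKA.
by rewrite BDl -!addrA; congr (_ + (_ + _)); rewrite addrC.
Qed.

End point_removal.

(** * Partitions as monotone sequences *)

Section chains.
Context {R : realType}.

(** Repetitions and free endpoints are allowed, so that skipping an index or clamping the values
    again yields a chain. *)
Definition chain (a b : R) (u : nat -> R) : Prop :=
  {homo u : m n / (m <= n)%N >-> m <= n} /\ forall n, a <= u n <= b.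

Lemma chain_comp a b u (s : nat -> nat) :
  {homo s : m n / (m <= n)%N} -> chain a b u -> chain a b (u \o s).
Proof. by move=> sm [um uab]; split=> [m n mn|n] /=; [exact/um/sm|exact: uab]. Qed.

Lemma chain_widen a b c d u : c <= a -> b <= d -> chain a b u -> chain c d u.
Proof.
move=> ca bd [um uab]; split=> // n; have /andP[au ub] := uab n.
by rewrite (le_trans ca au) (le_trans ub bd).
Qed.

Definition varsum {W : normedModType R} p (h : R -> W) (u : nat -> R) n : R :=
  \sum_(i < n) `|h (u i.+1) - h (u i)| `^ p.

End chains.

Lemma bump_homo h : {homo bump h : m n / (m <= n)%N}.
Proof. by move=> m n mn; rewrite leq_bump2. Qed.

(** * The Young bound by successive removals *)

Section young_bound.
Context {R : realType} {X Y V : normedModType R} (B : X -> Y -> V).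
Context (BDl : forall x x' y, B (x + x') y = B x y + B x' y).
Context (BDr : forall x y y', B x (y + y') = B x y + B x y').
Context (normB : forall x y, `|B x y| <= `|x| * `|y|).
Implicit Types (f : R -> X) (g : R -> Y) (u v : nat -> R).

(** The intervals are removed one by one down to the empty sum; [c m] is the cost when [m.+1] of
    them are left. *)
Lemma tag_error_le f g a b (c : nat -> R) :
  (forall n u v, chain a b u -> chain a b v -> exists2 k, (k <= n)%N &
    `|f (u k.+1) - f (u k)| * `|g (v k.+1) - g (v k)| <= c n) ->
  forall n u v, chain a b u -> chain a b v ->
  `|tag_error B n (f \o u) (g \o v)| <= \sum_(0 <= m < n) c m.
Proof.
move=> Hc; elim=> [|n IHn] u v cu cv.
  by rewrite /tag_error !big_geq// normr0.
have [k kn Hk] := Hc n u v cu cv.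
rewrite (tag_error_remove BDl BDr _ _ kn) big_nat_recr//=.
rewrite (le_trans (ler_normD _ _))// lerD//.
  by apply: (IHn (u \o bump k.+1) (v \o bump k)); apply: chain_comp => //;
    exact: bump_homo.
exact: le_trans (normB _ _) Hk.
Qed.

(* Normalizing the two variations to total mass 1 and adding them up makes a
   single index good for both increments. *)
Lemma small_increments f g a b p q A C : 0 < p -> 0 < q -> 0 < A -> 0 < C ->
  (forall u n, chain a b u -> varsum p f u n <= A) ->
  (forall u n, chain a b u -> varsum q g u n <= C) ->
  forall n u v, chain a b u -> chain a b v -> exists2 k, (k <= n)%N &
    `|f (u k.+1) - f (u k)| <= (2 * A) `^ p^-1 * n.+1%:R `^ (- p^-1) /\
    `|g (v k.+1) - g (v k)| <= (2 * C) `^ q^-1 * n.+1%:R `^ (- q^-1).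
Proof.
move=> p0 q0 A0 C0 fA gB n u v cu cv.
pose F k := `|f (u k.+1) - f (u k)| `^ p / A + `|g (v k.+1) - g (v k)| `^ q / C.
have /sum_le_exists_le[k kn Fk] : \sum_(i < n.+1) F i <= 2.
  rewrite big_split/= -!mulr_suml -[2]/(1 + 1 : R).
  by rewrite lerD// ler_pdivrMr// mul1r; [exact: fA|exact: gB].
have root (z M r : R) : 0 < r -> 0 < M -> 0 <= z -> z `^ r / M <= 2 / n.+1%:R ->
    z <= (2 * M) `^ r^-1 * n.+1%:R `^ (- r^-1).
  move=> r0 M0 z0; rewrite ler_pdivrMr// => H.
  have {H} : (z `^ r) `^ r^-1 <= (2 / n.+1%:R * M) `^ r^-1.
    apply: ge0_ler_powR => //; rewrite ?nnegrE ?powR_ge0 ?invr_ge0 ?ltW//.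
    by rewrite mulr_gt0// divr_gt0.
  rewrite -powRrM mulfV ?gt_eqF// powRr1// => /le_trans; apply.
  have M2 : 0 <= 2 * M by rewrite mulr_ge0 ?ltW.
  by rewrite mulrAC [leLHS]powRM// -[n.+1%:R^-1]powR_inv1// -powRrM mulN1r.
exists k => //; split; apply: root => //; apply: le_trans Fk.
  by rewrite lerDl divr_ge0 ?powR_ge0// ltW.
by rewrite lerDr divr_ge0 ?powR_ge0// ltW.
Qed.

(** The first summand comes from the partial sum of [m ^ (- 1/q)], the second from the tail of
    [m ^ (- (1/p + 1/q))]. The powers of 2 come from [2 * A], [2 * C] and from rounding the cut to
    an integer. *)
Definition young_const (p q : R) : R := 2 `^ q^-1 *
  ((1 - q^-1)^-1 + 2 `^ (p^-1 + (p^-1 + q^-1 - 1)) / (p^-1 + q^-1 - 1)).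

(* The increments of f are bounded by O for the last N = A / O ^ p removals and
   by (A / m) ^ (1 / p) before. *)
Lemma young_bound f g a b p q A C O : 1 < p -> 1 < q -> 1 < p^-1 + q^-1 ->
  0 < O -> O `^ p <= A -> 0 < C ->
  (forall x y, a <= x <= b -> a <= y <= b -> `|f x - f y| <= O) ->
  (forall u n, chain a b u -> varsum p f u n <= A) ->
  (forall u n, chain a b u -> varsum q g u n <= C) ->
  forall n u v, chain a b u -> chain a b v ->
  `|tag_error B n (f \o u) (g \o v)| <=
    young_const p q * A `^ (1 - q^-1) * O `^ (1 + p / q - p) * C `^ q^-1.
Proof.
move=> p1 q1 pq O0 OA C0 fO fA gB n u v cu cv.
have p0 : 0 < p by exact: lt_trans p1.
have q0 : 0 < q by exact: lt_trans q1.
have q'01 : 0 < q^-1 < 1 by rewrite invr_gt0 q0 invf_lt1.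
have Op0 : 0 < O `^ p by exact: powR_gt0.
have A0 : 0 < A by exact: lt_le_trans OA.
(* At about [N] intervals the bounds [O] and [(A / m) ^ (1/p)] on an increment of [f] agree. *)
have [N NE] : {N | N = A / O `^ p} by exists (A / O `^ p).
have N1 : 1 <= N by rewrite NE ler_pdivlMr// mul1r.
have N0 : 0 < N by exact: lt_le_trans N1.
have AE : A = N * O `^ p by rewrite NE divfK// gt_eqF.
pose k := Num.truncn N.
have /andP[kN Nk] : k%:R <= N < k.+1%:R by exact: truncn_itv (ltW N0).
have k0 : (0 < k)%N by rewrite -ltnS -(ltr_nat R) (le_lt_trans N1 Nk).
(* As [k >= 1], [N < k + 1 <= 2 k]; replacing [k] by [N] in the tail thus costs only a factor
   [2 ^ s]. *)
have N2k : N / 2 <= k%:R.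
  have : 1 <= k%:R :> R by rewrite ler1n.
  by move: Nk; rewrite -natr1; lra.
pose c m : R := if (m < k)%N then O * ((2 * C) `^ q^-1 * m.+1%:R `^ (- q^-1))
  else (2 * A) `^ p^-1 * (2 * C) `^ q^-1 * m.+1%:R `^ (- (p^-1 + q^-1)).
have c0 m : 0 <= c m by rewrite /c; case: ifP; rewrite !mulr_ge0 ?powR_ge0 ?ltW.
have cP m u' v' : chain a b u' -> chain a b v' -> exists2 j, (j <= m)%N &
    `|f (u' j.+1) - f (u' j)| * `|g (v' j.+1) - g (v' j)| <= c m.
  move=> cu' cv'.
  have [j jm [fj gj]] := small_increments p0 q0 A0 C0 fA gB m cu' cv'.
  exists j => //; rewrite /c; case: ifP => _.
    apply: ler_pM => //; apply: fO; exact: cu'.2.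
  rewrite opprD powRD; last by rewrite (gt_eqF (ltr0Sn _ _)) implybT.
  by rewrite mulrACA ler_pM.
rewrite (le_trans (tag_error_le cP n cu cv))//.
(* Padding the sum makes the cut at [k] meaningful also when [n < k]. *)
rewrite (@le_trans _ _ (\sum_(0 <= m < maxn n k) c m))//.
  by rewrite [leRHS](big_cat_nat (n := n)) ?leq_maxl//= lerDl sumr_ge0.
rewrite (big_cat_nat (n := k)) ?leq_maxr//=.
under eq_big_nat => m /andP[_ mk] do rewrite /c mk mulrA.
under [X in _ + X]eq_big_nat => m /andP[km _] do rewrite /c ltnNge km /=.
rewrite -!mulr_sumr.
have S1 := @ler_sum_powRN_lt1 R q^-1 k q'01.
have S2 := @ler_sum_powRN_gt1 R (p^-1 + q^-1) k (maxn n k) pq k0.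
set r := q^-1 in q'01 S1 S2 *; have /andP[r0 r1] := q'01.
set s := p^-1 + r - 1.
have s0 : 0 < s by rewrite subr_gt0.
have kb : k%:R `^ (1 - r) <= N `^ (1 - r).
  by apply: ge0_ler_powR; rewrite ?nnegrE// ?subr_ge0 ltW.
have ks : k%:R `^ (1 - (p^-1 + r)) <= N `^ (- s) * 2 `^ s.
  have -> : 1 - (p^-1 + r) = - s by rewrite opprB.
  rewrite powRN (@le_trans _ _ ((N / 2) `^ s)^-1)//.
    rewrite lef_pV2 ?posrE ?powR_gt0 ?divr_gt0 ?ltr0n//.
    by apply: ge0_ler_powR; rewrite ?nnegrE// ltW// divr_gt0.
  rewrite powRM ?(ltW N0) ?invr_ge0// invfM powRN ler_pM2l ?invr_gt0 ?powR_gt0//.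
  by rewrite -[2^-1]powR_inv1// -powRrM mulN1r powRN invrK.
rewrite (@le_trans _ _ (O * (2 * C) `^ r * (N `^ (1 - r) / (1 - r)) +
   (2 * A) `^ p^-1 * (2 * C) `^ r * (N `^ (- s) * 2 `^ s / s)))//.
  apply: lerD.
    rewrite ler_wpM2l ?mulr_ge0 ?powR_ge0 ?(ltW O0)//= (le_trans S1)//.
    by rewrite ler_wpM2r// invr_ge0 subr_ge0 ltW.
  rewrite ler_wpM2l ?mulr_ge0 ?powR_ge0//= (le_trans S2)//.
  by rewrite ler_wpM2r// invr_ge0 ltW.
(* By [A = N * O ^ p] and [1 - 1/q = 1/p - s], the tail is a multiple of the same
   [O * N ^ (1 - 1/q)] as the head. *)
have -> : (2 * A) `^ p^-1 * (2 * C) `^ r * (N `^ (- s) * 2 `^ s / s) =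
    O * N `^ (1 - r) * (2 `^ r * C `^ r) * (2 `^ (p^-1 + s) / s).
  rewrite AE !powRM ?mulr_ge0 ?powR_ge0 ?(ltW N0) ?(ltW C0)// -(powRrM O) mulfV ?gt_eqF//.
  rewrite powRr1 ?(ltW O0)// (@powRD _ 2 p^-1 s) ?(gt_eqF (ltr0Sn _ _)) ?implybT//.
  have -> : 1 - r = p^-1 + - s by rewrite /s; ring.
  rewrite (powRD (x := N)) ?(gt_eqF N0) ?implybT//.
  by ring.
rewrite -[_ * A `^ _ * _]mulrA.
have -> : A `^ (1 - r) * O `^ (1 + p * r - p) = O * N `^ (1 - r).
  rewrite AE powRM ?powR_ge0 ?(ltW N0)// -powRrM -mulrA -powRD ?(gt_eqF O0) ?implybT//.
  have -> : p * (1 - r) + (1 + p / q - p) = 1 by rewrite /r; ring.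
  by rewrite powRr1 ?(ltW O0)// mulrC.
rewrite powRM ?(ltW C0)//.
have -> : young_const p q = 2 `^ r * ((1 - r)^-1 + 2 `^ (p^-1 + s) / s) by [].
rewrite le_eqVlt; apply/orP; left; apply/eqP; ring.
Qed.

End young_bound.

(** * Comparison of a Riemann sum with a common refinement *)

Section refinement.
Context {R : realType} {X Y V : normedModType R} (B : X -> Y -> V).
Context (BDl : forall x x' y, B (x + x') y = B x y + B x' y).
Context (BDr : forall x y y', B x (y + y') = B x y + B x y').
Context (normB : forall x y, `|B x y| <= `|x| * `|y|).
Implicit Types (f : R -> X) (g : R -> Y) (u v : nat -> R).

(** Midpoint of 1 and [1/p + 1/q]: above 1 for summability, below [1/p + 1/q] so that a positive
    power of the modulus is left over. *)
Definition mid_exponent (p q : R) : R := (1 + (p^-1 + q^-1)) / 2.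

Definition interp_weight (p q : R) : R := mid_exponent p q / (p^-1 + q^-1).

(** The first factor bounds the sum of [m ^ (- mid_exponent)]. The last one comes from [w ^
    mid_exponent <= w * W ^ (mid_exponent - 1)], which keeps the local estimate linear in [w], hence
    summable over intervals. *)
Definition local_const (p q e W : R) : R :=
  (1 + (mid_exponent p q - 1)^-1) * e `^ (1 - interp_weight p q) * W `^ (mid_exponent p q - 1).

(* Interpolating Z <= e and Z <= (w / m) ^ (1 / p + 1 / q) yields a summable
   bound on Z that is small with e. *)
Lemma local_tag_error_le f g s t p q e w W :
  0 < p -> 0 < q -> 1 < p^-1 + q^-1 -> 0 <= w <= W ->
  (forall u v n, chain s t u -> chain s t v ->
    varsum p f u n + varsum q g v n <= w) ->
  (forall x x' y y', s <= x <= t -> s <= x' <= t -> s <= y <= t ->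
    s <= y' <= t -> `|f x - f x'| * `|g y - g y'| <= e) ->
  forall n u v, chain s t u -> chain s t v ->
  `|tag_error B n (f \o u) (g \o v)| <= local_const p q e W * w.
Proof.
move=> p0 q0 pq /andP[w0 wW] fgw fge n u v cu cv.
set mu := p^-1 + q^-1 in pq *.
have mu0 : 0 < mu by exact: lt_trans pq.
have sg1 : 1 < mid_exponent p q by rewrite /mid_exponent -/mu; lra.
have sg10 : 0 < mid_exponent p q - 1 by rewrite subr_gt0.
have lm : mu * interp_weight p q = mid_exponent p q.
  by rewrite mulrC divfK// gt_eqF.
have lm0 : 0 <= interp_weight p q by rewrite divr_ge0// ltW// (lt_trans _ sg1).
have lm1 : interp_weight p q <= 1 by rewrite ler_pdivrMr// mul1r /mid_exponent -/mu; lra.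
pose c m : R :=
  e `^ (1 - interp_weight p q) * w `^ mid_exponent p q * m.+1%:R `^ (- mid_exponent p q).
have cP m u' v' : chain s t u' -> chain s t v' -> exists2 j, (j <= m)%N &
    `|f (u' j.+1) - f (u' j)| * `|g (v' j.+1) - g (v' j)| <= c m.
  move=> cu' cv'.
  have := fgw u' v' m.+1 cu' cv'; rewrite /varsum -big_split/=.
  move=> /(@sum_le_exists_le _ m (fun j => `|f (u' j.+1) - f (u' j)| `^ p +
    `|g (v' j.+1) - g (v' j)| `^ q))[j jm].
  set x := `|_|; set y := `|_|; set wm := w / _ => xyw.
  exists j => //.
  have wm0 : 0 <= wm by rewrite divr_ge0.
  have root (z r : R) : 0 < r -> 0 <= z -> z `^ r <= wm -> z <= wm `^ r^-1.
    move=> r0 z0 zr; rewrite -[z]powRr1// -(mulfV (lt0r_neq0 r0)) powRrM.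
    by apply: ge0_ler_powR; rewrite ?nnegrE ?powR_ge0// invr_ge0 ltW.
  have x0 : 0 <= x by exact: normr_ge0.
  have y0 : 0 <= y by exact: normr_ge0.
  have xy0 : 0 <= x * y by exact: mulr_ge0.
  have xye : x * y <= e by apply: fge; [exact: cu'.2|exact: cu'.2|exact: cv'.2|exact: cv'.2].
  have xym : x * y <= wm `^ mu.
    rewrite powRD ?(gt_eqF mu0)//; apply: ler_pM => //; apply: root => //.
      by rewrite (le_trans _ xyw)// lerDl powR_ge0.
    by rewrite (le_trans _ xyw)// lerDr powR_ge0.
  (* The product is split into its powers [1 - l] and [l], with [l] the interpolation weight, and
     each bound is used on one factor. *)
  rewrite -[leLHS]powRr1// -[1](subrK (interp_weight p q)) powRD ?subrK ?oner_eq0//.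
  rewrite /c -mulrA; apply: ler_pM; rewrite ?powR_ge0//.
    by apply: ge0_ler_powR; rewrite ?nnegrE ?subr_ge0// (le_trans xy0).
  have -> : w `^ mid_exponent p q * m.+1%:R `^ (- mid_exponent p q) =
      (wm `^ mu) `^ interp_weight p q.
    rewrite -powRrM lm /wm powRM ?invr_ge0//; congr (_ * _).
    by rewrite -[m.+1%:R^-1]powR_inv1// -powRrM mulN1r.
  by apply: ge0_ler_powR; rewrite ?nnegrE ?powR_ge0.
rewrite (le_trans (tag_error_le BDl BDr normB cP n cu cv))//.
rewrite -mulr_sumr.
have -> : local_const p q e W * w = e `^ (1 - interp_weight p q) *
   (w * W `^ (mid_exponent p q - 1)) * (1 + (mid_exponent p q - 1)^-1).
  by rewrite /local_const; ring.
apply: ler_pM; rewrite ?mulr_ge0 ?powR_ge0 ?sumr_ge0//.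
  rewrite ler_wpM2l ?powR_ge0// -(@mulr_powRB1 _ w)//; last exact: lt_trans sg1.
  rewrite ler_wpM2l//; apply: ge0_ler_powR; rewrite ?nnegrE ?(ltW sg10)//.
  exact: le_trans wW.
case: n {cu cv} => [|n]; first by rewrite big_geq// addr_ge0// invr_ge0 ltW.
(* The term [m = 0] equals 1; the tail estimate applies from index 1 on. *)
rewrite big_ltn// powR1 lerD2l.
have := @ler_sum_powRN_gt1 R (mid_exponent p q) 1 n.+1 sg1 isT.
by rewrite powR1 div1r.
Qed.

(** The exponent [1 - interp_weight] of [d] is positive, so the constant tends to 0 with [d]. *)
Lemma local_const_small p q W e : 1 < p^-1 + q^-1 -> 0 < e ->
  exists2 d, 0 < d & local_const p q d W * W <= e.
Proof.
move=> pq e0; set mu := p^-1 + q^-1 in pq *.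
have mu0 : 0 < mu by exact: lt_trans pq.
have l1 : 0 < 1 - interp_weight p q.
  rewrite subr_gt0 ltr_pdivrMr// mul1r /mid_exponent -/mu; lra.
have sg1 : 0 < mid_exponent p q - 1 by rewrite /mid_exponent -/mu; lra.
pose D := (1 + (mid_exponent p q - 1)^-1) * W `^ (mid_exponent p q - 1) * `|W|.
have D0 : 0 <= D by rewrite !mulr_ge0 ?powR_ge0// addr_ge0// invr_ge0 ltW.
have D1 : 0 < D + 1 by rewrite ltr_wpDl.
(* Solves [d ^ (1 - interp_weight) = e / (D + 1)]; the 1 guards against [D = 0]. *)
exists ((e / (D + 1)) `^ (1 - interp_weight p q)^-1).
  by rewrite powR_gt0// divr_gt0.
rewrite /local_const -powRrM mulVf ?gt_eqF// powRr1; last by rewrite divr_ge0 ?ltW.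
rewrite (@le_trans _ _ (e / (D + 1) * D))//.
  rewrite [leRHS](_ : _ = (1 + (mid_exponent p q - 1)^-1) * (e / (D + 1)) *
    W `^ (mid_exponent p q - 1) * `|W|); last by rewrite /D; ring.
  rewrite ler_wpM2l ?ler_norm// !mulr_ge0 ?powR_ge0//.
  - by rewrite addr_ge0// invr_ge0 ltW.
  - exact: ltW.
  - by rewrite invr_ge0 ltW.
by rewrite mulrAC ler_pdivrMr// ler_pM2l// lerDl.
Qed.

Definition rs_sum f g n (xi t : nat -> R) : V :=
  \sum_(i < n) B (f (xi i)) (g (t i.+1) - g (t i)).

Definition tagged_chain (a b : R) n (xi t : nat -> R) : Prop :=
  [/\ chain a b t, t 0%N = a, t n = b &
      forall i, (i < n)%N -> t i <= xi i <= t i.+1].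

Lemma pairing0r x : B x 0 = 0.
Proof. by apply/(addrI (B x 0)); rewrite -BDr !addr0. Qed.

Lemma pairingBl x x' y : B (x - x') y = B x y - B x' y.
Proof. by apply/eqP; rewrite eq_sym subr_eq -BDl subrK. Qed.

Lemma pairing_sumr x n (F : nat -> Y) :
  B x (\sum_(i < n) F i) = \sum_(i < n) B x (F i).
Proof.
elim: n => [|n IHn]; first by rewrite !big_ord0 pairing0r.
by rewrite !big_ord_recr/= BDr IHn.
Qed.

Lemma tag_error_rs_sum f g n c xi t :
  tag_error B n (f \o (fun i => if i is j.+1 then xi j else c)) (g \o t) =
  rs_sum f g n xi t - B (f c) (g (t n) - g (t 0%N)).
Proof.
rewrite /tag_error /rs_sum /= big_mkord.
rewrite (eq_bigr (fun i : 'I_n => B (f (xi i)) (g (t i.+1) - g (t i)) -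
  B (f c) (g (t i.+1) - g (t i)))); last by move=> i _; exact: pairingBl.
rewrite big_split/= sumrN; congr (_ - _).
rewrite -(@pairing_sumr (f c) n (fun i => g (t i.+1) - g (t i))); congr (B _ _).
by rewrite -(telescope_sumr (fun i => g (t i)))// big_mkord.
Qed.

(** Only tags of index below [n] are controlled, so the later ones are replaced by [b]. Successive
    tags are ordered because a partition point separates them. *)
Lemma chain_tags a b n xi t : a <= b -> tagged_chain a b n xi t ->
  exists2 u, chain a b u & forall i, (i <= n)%N ->
    u i = if i is j.+1 then xi j else a.
Proof.
move=> ab [[tm tab] t0 tn txi].
exists (fun i => if i is j.+1 then if (j < n)%N then xi j else b else a).
  have xiab j : (j < n)%N -> a <= xi j <= b.
    move=> jn; have /andP[h1 h2] := txi _ jn.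
    have /andP[h3 _] := tab j; have /andP[_ h4] := tab j.+1.
    by rewrite (le_trans h3 h1) (le_trans h2 h4).
  split=> [[|i] [|j]//|[|i]]; rewrite ?lexx//.
  - by case: ifP => // jn _; have /andP[] := xiab _ jn.
  - rewrite ltnS => ij; have [jn|nj] := ltnP j n; last first.
      by case: ifP => // iin; have /andP[] := xiab _ iin.
    rewrite (leq_ltn_trans ij jn).
    move: ij; rewrite leq_eqVlt => /predU1P[->//|ij].
    have /andP[_ h1] := txi _ (ltn_trans ij jn); have /andP[h2 _] := txi _ jn.
    exact: le_trans h1 (le_trans (tm _ _ ij) h2).
  - by case: ifP => [/xiab//|_]; rewrite ab lexx.
by move=> [|i]// ->.
Qed.

Lemma eq_tag_error n (x x' : nat -> X) (y : nat -> Y) :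
  (forall i, (i <= n)%N -> x i = x' i) -> tag_error B n x y = tag_error B n x' y.
Proof.
move=> xx'; rewrite /tag_error; apply: eq_big_nat => i /andP[_ ilt].
by rewrite !xx'.
Qed.

Definition clamp (s t x : R) := Num.max s (Num.min t x).

Lemma clamp_chain a b u s t : s <= t -> chain a b u ->
  chain s t (fun i => clamp s t (u i)).
Proof.
move=> st [um _]; split=> [m n mn|n]; rewrite /clamp.
  have := um _ _ mn.
  by case: (leP t (u m)); case: (leP t (u n)) => h1 h2 h3;
    rewrite ge_max le_max lexx/= ?le_max; case: (leP s t); case: (leP s (u n));
    case: (leP s (u m)); lra.
by rewrite le_max lexx ge_max st ge_min lexx.
Qed.

(* Riemann sum over the common refinement of the partitions t and r, tagged at
   left endpoints: clamping r to [t i, t i.+1] enumerates the points of r there,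
   up to repetitions, which contribute 0. *)
Definition merged_sum f g n m (t r : nat -> R) : V :=
  \sum_(i < n) rs_sum f g m (fun j => clamp (t i) (t i.+1) (r j))
                            (fun j => clamp (t i) (t i.+1) (r j)).

(** The [(i, j)] term of either side lives on the intersection of [[t i, t i.+1]] and
    [[r j, r j.+1]], tagged at its left end; for disjoint intervals clamping makes the increment
    0. *)
Lemma merged_sumC f g n m t r a b : chain a b t -> chain a b r ->
  merged_sum f g n m t r = merged_sum f g m n r t.
Proof.
move=> [tm _] [rm _]; rewrite /merged_sum /rs_sum exchange_big/=.
apply: eq_bigr => j _; apply: eq_bigr => i _.
have := tm _ _ (leqnSn i); have := rm _ _ (leqnSn j).
move: (t i) (t i.+1) (r j) (r j.+1) => s t' s' r' s'r' st'.
rewrite /clamp; case: (boolP (t' < s')) => [t's'|].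
  rewrite (min_l (ltW t's')) (min_l (le_trans (ltW t's') s'r')) subrr pairing0r.
  rewrite (min_r (le_trans st' (le_trans (ltW t's') s'r'))).
  rewrite (min_r (le_trans (ltW t's') s'r')) (max_l (le_trans st' (ltW t's'))).
  by rewrite (max_l (ltW t's')) subrr pairing0r.
rewrite -leNgt => s't'; case: (boolP (r' < s)) => [r's|].
  rewrite (min_l (ltW r's)) (min_l (le_trans (ltW r's) st')) subrr pairing0r.
  rewrite (min_r s't') (min_r (le_trans (ltW r's) st')).
  by rewrite (max_l (ltW r's)) (max_l (le_trans s'r' (ltW r's))) subrr pairing0r.
rewrite -leNgt => sr'.
have sm : s <= Num.min t' r' by rewrite le_min st'.
have s'm : s' <= Num.min t' r' by rewrite le_min s't'.
by rewrite (min_r s't') (min_r sr') (minC r') (max_r sm) (max_r s'm) (maxC s).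
Qed.

(** On each interval of [t], both the term tagged by [xi] and the refined sum are compared with the
    term tagged at the left end, hence the factor 2. The errors are linear in the increments of
    [phi], which telescope. *)
Lemma rs_sum_merged_le f g a b p q e (phi : R -> R) n xi t m r eta :
  0 < p -> 0 < q -> 1 < p^-1 + q^-1 ->
  (forall s s', a <= s -> s <= s' -> s' <= b ->
    forall u v k, chain s s' u -> chain s s' v ->
    varsum p f u k + varsum q g v k <= phi s' - phi s) ->
  tagged_chain a b n xi t -> tagged_chain a b m eta r ->
  (forall i, (i < n)%N -> forall x x' y y',
    t i <= x <= t i.+1 -> t i <= x' <= t i.+1 ->
    t i <= y <= t i.+1 -> t i <= y' <= t i.+1 ->
    `|f x - f x'| * `|g y - g y'| <= e) ->
  `|rs_sum f g n xi t - merged_sum f g n m t r| <=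
     2 * local_const p q e (phi b - phi a) * (phi b - phi a).
Proof.
move=> p0 q0 pq fgphi [[tm tab] t0 tn txi] [cr r0 rm _] fge.
have phim s s' : a <= s -> s <= s' -> s' <= b -> phi s <= phi s'.
  move=> as' ss' s'b; rewrite -subr_ge0.
  have cs : chain s s' (fun=> s) by split=> // _; rewrite lexx.
  by have := fgphi s s' as' ss' s'b _ _ 0%N cs cs; rewrite /varsum !big_ord0 addr0.
rewrite -sumrB (le_trans (ler_norm_sum _ _ _))//.
have -> : phi b - phi a = \sum_(i < n) (phi (t i.+1) - phi (t i)).
  by rewrite -(big_mkord xpredT (fun i => phi (t i.+1) - phi (t i))) telescope_sumr// tn t0.
rewrite mulr_sumr; apply: ler_sum => i _.
rewrite -(big_mkord xpredT (fun i => phi (t i.+1) - phi (t i))) telescope_sumr// tn t0.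
set s := t i; set s' := t i.+1.
have ss' : s <= s' by exact: tm.
have [as_ sb] : a <= s /\ s <= b by apply/andP; exact: tab.
have [as'_ s'b] : a <= s' /\ s' <= b by apply/andP; exact: tab.
have w0 : 0 <= phi s' - phi s <= phi b - phi a.
  by rewrite subr_ge0 phim//= lerB// phim// (le_trans ss').
have loc := local_tag_error_le p0 q0 pq w0 (fgphi _ _ as_ ss' s'b) (fge i (ltn_ord i)).
have cv := clamp_chain ss' cr.
set v := fun j => _ in cv.
have v0 : v 0%N = s by rewrite /v r0 /clamp (min_r as'_) max_l.
have vm : v m = s' by rewrite /v rm /clamp (min_l s'b) max_r.
(* [c1] gives the refined tags, namely [v] itself after the base [s]; [c2] and [c3] describe
   [[s, s']] as one interval tagged by [xi i]. *)
have c1 : chain s s' (fun j => if j is k.+1 then v k else s).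
  by split=> [[|j] [|k]//|[|j]]; rewrite ?lexx//;
    [have /andP[] := cv.2 k|rewrite ltnS; exact: cv.1|exact: cv.2].
have xis : s <= xi i <= s' by exact: txi.
have c2 : chain s s' (fun j => if j is k.+1 then xi i else s).
  by split=> [[|j] [|k]//|[|j]]; rewrite ?lexx//; have /andP[] := xis.
have c3 : chain s s' (fun j => if j is k.+1 then s' else s).
  by split=> [[|j] [|k]//|[|j]]; rewrite ?lexx// ss'.
have := loc m _ _ c1 cv; rewrite tag_error_rs_sum v0 vm.
have := loc 1%N _ _ c2 c3; rewrite (tag_error_rs_sum f g 1 s (fun=> xi i)).
rewrite {1}/rs_sum big_ord1 => h1 h2.
rewrite -mulrA mulrDl !mul1r -[B _ _](subrK (B (f s) (g s' - g s))) -addrA.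
rewrite (le_trans (ler_normD _ _))// lerD//.
by rewrite distrC.
Qed.

End refinement.

(** * Superadditivity of the variation *)

Section variation_control.
Context {R : realType} {W : normedModType R}.
Implicit Types (h : R -> W) (u w : nat -> R).

Lemma varsum_ge0 p h u n : 0 <= varsum p h u n.
Proof. by apply: sumr_ge0 => i _; exact: powR_ge0. Qed.

(** Concatenation creates one extra jump, from [w m] to [u 0], which can only increase the sum. *)
Lemma varsum_cat p h a s t u w n m : chain a s w -> chain s t u ->
  exists2 z, chain a t z &
    varsum p h w m + varsum p h u n <= varsum p h z (m.+1 + n).
Proof.
move=> [wm wa] [um ua].
exists (fun i => if (i <= m)%N then w i else u (i - m.+1)%N).
  split=> [i j ij|i].
    case: ifPn => im; case: ifPn => jm.
    - exact: wm.
    - have /andP[_ h1] := wa i; have /andP[h2 _] := ua (j - m.+1)%N.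
      exact: le_trans h2.
    - by rewrite (leq_trans ij jm) in im.
    - by apply: um; exact: leq_sub2r.
  have /andP[h1 h2] := ua (i - m.+1)%N; have /andP[h3 h4] := wa i.
  have /andP[h5 h6] := ua 0%N; have /andP[h7 h8] := wa 0%N.
  case: ifP => _; first by rewrite h3 (le_trans h4 (le_trans h5 h6)).
  by rewrite h2 andbT (le_trans h7 (le_trans h8 h1)).
rewrite /varsum big_split_ord/= big_ord_recr/= -!addrA lerD//.
  apply: ler_sum => i _ /=.
  by rewrite (ltn_ord i) (ltnW (ltn_ord i)).
rewrite ler_wpDl ?powR_ge0//; apply: ler_sum => i _ /=.
have gtm k : (m.+1 + k <= m)%N = false by rewrite addSn ltnNge leq_addr.
by rewrite -addnS !gtm !addKn.
Qed.

(** [phi t] is the variation over [[a, t]]; appending a chain in [[s, t]] to one in [[a, s]] gives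
    superadditivity. *)
Lemma control_exists p h a b A :
  (forall u n, chain a b u -> varsum p h u n <= A) ->
  exists phi : R -> R, forall s t, a <= s -> s <= t -> t <= b ->
    forall u n, chain s t u -> varsum p h u n <= phi t - phi s.
Proof.
move=> hA; pose S t := [set x | exists u n, chain a t u /\ x = varsum p h u n].
exists (fun t => sup (S t)) => s t as_ st tb u n cu.
have S0 r : a <= r -> S r !=set0.
  move=> ar; exists (varsum p h (fun=> a) 0), (fun=> a), 0%N; split=> //.
  by split=> // _; rewrite lexx.
have Sub : has_ubound (S t).
  exists A => _ [v [m [cv ->]]]; apply: hA; exact: chain_widen cv.
rewrite lerBrDl -lerBrDr; apply: ge_sup; first exact: S0.
move=> _ [w [m [cw ->]]]; rewrite lerBrDr.
have [z cz /le_trans] := varsum_cat p h n m cw cu; apply.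
by apply: ub_le_sup => //; exists z, (m.+1 + n)%N.
Qed.

Lemma dist_le_varsum p h a b A : 0 < p ->
  (forall u n, chain a b u -> varsum p h u n <= A) ->
  forall x y, a <= x <= b -> a <= y <= b -> `|h x - h y| <= A `^ p^-1.
Proof.
move=> p0 hA.
suff H x y : a <= x <= b -> a <= y <= b -> x <= y -> `|h y - h x| <= A `^ p^-1.
  move=> x y hx hy; have [xy|/ltW yx] := leP x y; last exact: H.
  by rewrite distrC; exact: H.
move=> hx hy xy.
have := hA (fun i => if i is _.+1 then y else x) 1%N.
rewrite /varsum big_ord1 => H.
rewrite -[leLHS]powRr1// -(mulfV (lt0r_neq0 p0)) powRrM.
have {}H : `|h y - h x| `^ p <= A by apply: H; split=> [[|i] [|j]|[|i]].
apply: ge0_ler_powR; rewrite ?nnegrE ?powR_ge0 ?invr_ge0 ?(ltW p0)//.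
by rewrite (le_trans _ H) ?powR_ge0.
Qed.

End variation_control.

(** * A uniform modulus for the product of increments *)

Section common_modulus.
Context {R : realType} {X Y : normedModType R}.

Lemma continuous_in_at_modulus (W : normedModType R) a b (h : R -> W) x e :
  0 < e -> continuous_in_at a b h x ->
  exists2 r, 0 < r & forall y y', a <= y <= b -> a <= y' <= b ->
    `|x - y| < r -> `|x - y'| < r -> `|h y - h y'| <= e.
Proof.
move=> e0 /cvgrPdist_lt/(_ (e / 2)); rewrite divr_gt0// => /(_ isT).
rewrite near_withinE => /nbhs_ballP[r /= r0 Hr].
exists r => // y y' yab y'ab xy xy'.
have Hy := Hr y xy; have Hy' := Hr y' xy'.
rewrite (splitr e) -(subrK (h x) (h y)) -addrA (le_trans (ler_normD _ _))//.
by apply: lerD; apply/ltW; [rewrite distrC; apply: Hy|apply: Hy']; rewrite /= in_itv.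
Qed.

(* At each point one of the two factors is small on a neighbourhood, the other
   one being bounded; compactness makes this uniform. *)
Lemma no_common_jump_modulus a b (f : R -> X) (g : R -> Y) M e :
  (forall x, x \in `[a, b] ->
     ~ (~ continuous_in_at a b f x /\ ~ continuous_in_at a b g x)) ->
  (forall x y, a <= x <= b -> a <= y <= b -> `|f x - f y| <= M) ->
  (forall x y, a <= x <= b -> a <= y <= b -> `|g x - g y| <= M) ->
  0 < e ->
  exists2 d, 0 < d & forall s t, a <= s -> t <= b -> t - s < d ->
    forall x x' y y', s <= x <= t -> s <= x' <= t -> s <= y <= t ->
      s <= y' <= t -> `|f x - f x'| * `|g y - g y'| <= e.
Proof.
move=> cfg fM gM e0.
pose M1 := `|M| + 1; have M10 : 0 < M1 by rewrite ltr_wpDl.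
have MM1 : M <= M1 by rewrite (le_trans (ler_norm _))// lerDl.
pose P d x := forall x1 x2 y1 y2,
  [/\ a <= x1 <= b, a <= x2 <= b, a <= y1 <= b & a <= y2 <= b] ->
  [/\ `|x - x1| < d, `|x - x2| < d, `|x - y1| < d & `|x - y2| < d] ->
  `|f x1 - f x2| * `|g y1 - g y2| <= e.
have /compact_near_coveringP/(_ R 0^'+ P _) := @segment_compact R a b.
have near_x x : `[a, b]%classic x -> \forall x' \near x & i \near 0^'+, P i x'.
  move=> xab.
  suff [r r0 Hr] : exists2 r, 0 < r & P r x.
    have r20 : 0 < r / 2 by rewrite divr_gt0.
    near=> x' d => /= x1 x2 y1 y2 h [h1 h2 h3 h4].
    have xx' : `|x - x'| < r / 2.
      by near: x'; exact: nbhsx_ballx.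
    have dr : d < r / 2 by near: d; exact: nbhs_right_lt.
    have tri z : `|x' - z| < d -> `|x - z| < r.
      move=> xz; rewrite -(subrK x' x) -addrA (le_lt_trans (ler_normD _ _))//.
      by rewrite (splitr r) ltrD// (lt_trans xz).
    by apply: Hr => //; split; exact: tri.
  have eM : 0 < e / M1 by rewrite divr_gt0.
  have [cf|ncf] := pselect (continuous_in_at a b f x).
    have [r r0 Hr] := continuous_in_at_modulus eM cf.
    exists r => // x1 x2 y1 y2 [h1 h2 h3 h4] [k1 k2 k3 k4].
    rewrite -(divfK (lt0r_neq0 M10) e); apply: ler_pM => //; first exact: Hr.
    by rewrite (le_trans (gM _ _ _ _)).
  have cg : continuous_in_at a b g x.
    by apply: contrapT => ncg; exact: (cfg x).
  have [r r0 Hr] := continuous_in_at_modulus eM cg.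
  exists r => // x1 x2 y1 y2 [h1 h2 h3 h4] [k1 k2 k3 k4].
  rewrite -(divfK (lt0r_neq0 M10) e) mulrC; apply: ler_pM => //; first exact: Hr.
  by rewrite (le_trans (fM _ _ _ _)).
move=> /(_ near_x) H.
have [d [d0 Hd]] : exists d, 0 < d /\ `[a, b]%classic `<=` P d.
  near (0:R)^'+ => d; exists d; split; first by [].
  by near: d.
exists d => // s t as_ tb std x x' y y' hx hx' hy hy'.
have mem z : s <= z <= t -> a <= z <= b /\ `|s - z| < d.
  move=> /andP[sz zt]; rewrite (le_trans as_ sz) (le_trans zt tb); split=> //.
  by rewrite distrC ger0_norm ?subr_ge0// (le_lt_trans _ std)// lerB.
(* All four points lie within [d] of [s], so the local property is used with centre [s]. *)
have sab : `[a, b]%classic s.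
  rewrite /= in_itv/= as_/=; have /andP[sx xt] := hx.
  exact: le_trans sx (le_trans xt tb).
have [? ?] := mem _ hx; have [? ?] := mem _ hx'.
have [? ?] := mem _ hy; have [? ?] := mem _ hy'.
exact: (Hd s sab).
Unshelve. all: by end_near. Qed.

End common_modulus.

(** * Existence of the limit, and the bound for each Riemann sum *)

Section existence.
Context {R : realType} {X Y : normedModType R} {V : completeNormedModType R}.
Context (B : X -> Y -> V).
Context (BDl : forall x x' y, B (x + x') y = B x y + B x' y).
Context (BDr : forall x y y', B x (y + y') = B x y + B x y').
Context (normB : forall x y, `|B x y| <= `|x| * `|y|).
Implicit Types (f : R -> X) (g : R -> Y) (a b p q A C e : R).

(** The merged sum is symmetric in the two partitions and serves as intermediate term; each
    comparison costs [e / 2]. *)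
Lemma rs_sum_cauchy f g a b p q A C : a <= b ->
  0 < p -> 0 < q -> 1 < p^-1 + q^-1 ->
  (forall x, x \in `[a, b] ->
     ~ (~ continuous_in_at a b f x /\ ~ continuous_in_at a b g x)) ->
  (forall u n, chain a b u -> varsum p f u n <= A) ->
  (forall u n, chain a b u -> varsum q g u n <= C) ->
  forall e, 0 < e -> exists2 d, 0 < d & forall n xi t m eta r,
    tagged_chain a b n xi t -> tagged_chain a b m eta r ->
    (forall i, (i < n)%N -> t i.+1 - t i < d) ->
    (forall i, (i < m)%N -> r i.+1 - r i < d) ->
    `|rs_sum B f g n xi t - rs_sum B f g m eta r| <= e.
Proof.
move=> ab p0 q0 pq cfg fA gC e e0.
have [phi1 Hphi1] := control_exists fA.
have [phi2 Hphi2] := control_exists gC.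
pose phi x := phi1 x + phi2 x.
have Hphi s s' : a <= s -> s <= s' -> s' <= b ->
    forall u v k, chain s s' u -> chain s s' v ->
    varsum p f u k + varsum q g v k <= phi s' - phi s.
  move=> h1 h2 h3 u v k cu cv; rewrite /phi opprD addrACA.
  by apply: lerD; [exact: Hphi1|exact: Hphi2].
have [e' e'0 He'] := @local_const_small R p q (phi b - phi a) (e / 4) pq
  (divr_gt0 e0 (ltr0Sn _ _)).
pose M := Num.max (A `^ p^-1) (C `^ q^-1).
have [||d d0 Hd] := @no_common_jump_modulus R X Y a b f g M e' cfg _ _ e'0.
- by move=> x y hx hy; rewrite le_max (dist_le_varsum p0 fA).
- by move=> x y hx hy; rewrite le_max orbC (dist_le_varsum q0 gC).
exists d => // n xi t m eta r tt tr td rd.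
have fge k s : chain a b s -> forall i, s i.+1 - s i < d ->
    forall x x' y y', s i <= x <= s i.+1 -> s i <= x' <= s i.+1 ->
      s i <= y <= s i.+1 -> s i <= y' <= s i.+1 ->
      `|f x - f x'| * `|g y - g y'| <= e'.
  by move=> [_ sab] i si; apply: Hd => //; [have /andP[] := sab i|have /andP[] := sab i.+1].
have [ct _ _ _] := tt; have [cr _ _ _] := tr.
rewrite -(subrK (merged_sum B f g n m t r) (rs_sum _ _ _ n _ _)) -addrA.
rewrite (le_trans (ler_normD _ _))//.
have -> : e = 2 * (e / 4) + 2 * (e / 4) by field.
have le2 : 2 * local_const p q e' (phi b - phi a) * (phi b - phi a) <= 2 * (e / 4).
  by rewrite -mulrA ler_pM2l.
apply: lerD; apply: (le_trans _ le2).
  by apply: (rs_sum_merged_le BDl BDr normB p0 q0 pq Hphi tt tr) => i ?;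
    apply: fge => //; exact: td.
rewrite (merged_sumC BDr f g n m ct cr) distrC.
by apply: (rs_sum_merged_le BDl BDr normB p0 q0 pq Hphi tr tt) => i ?;
   apply: fge => //; exact: rd.
Qed.

Lemma uniform_tagged a b n : a <= b -> exists t : nat -> R, tagged_chain a b n.+1 t t /\
  forall i, (i < n.+1)%N -> t i.+1 - t i <= (b - a) / n.+1%:R.
Proof.
move=> ab; pose h := (b - a) / n.+1%:R.
have h0 : 0 <= h by rewrite divr_ge0 ?subr_ge0.
have hb : a + h *+ n.+1 = b.
  by rewrite -[h *+ _]mulr_natr divfK ?pnatr_eq0// addrC subrK.
(* [minn] freezes the sequence at [b], since a chain is constrained at all indices. *)
pose t i := a + h *+ (minn i n.+1).
have tm : {homo t : i j / (i <= j)%N >-> i <= j}.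
  move=> i j ij; rewrite lerD2l ler_wpMn2l// leq_min geq_min.
  by rewrite ij geq_minr.
exists t; split.
  split.
  - split=> // i; rewrite lerDl mulrn_wge0//= -hb lerD2l ler_wpMn2l//.
    exact: geq_minr.
  - by rewrite /t min0n mulr0n addr0.
  - by rewrite /t minnn.
  - by move=> i _; rewrite lexx/= tm.
move=> i ilt; rewrite /t (minn_idPl ilt) (minn_idPl (ltnW ilt)).
by rewrite opprD addrACA subrr add0r mulrS addrK.
Qed.

(** Sums over uniform partitions converge by completeness of [V]; the Cauchy estimate carries the
    limit over to every fine partition. *)
Lemma rs_integral_exists f g a b p q A C : a <= b ->
  0 < p -> 0 < q -> 1 < p^-1 + q^-1 ->
  (forall x, x \in `[a, b] ->
     ~ (~ continuous_in_at a b f x /\ ~ continuous_in_at a b g x)) ->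
  (forall u n, chain a b u -> varsum p f u n <= A) ->
  (forall u n, chain a b u -> varsum q g u n <= C) ->
  exists I : V, forall e, 0 < e -> exists2 d, 0 < d & forall n xi t,
    tagged_chain a b n xi t -> (forall i, (i < n)%N -> t i.+1 - t i < d) ->
    `|I - rs_sum B f g n xi t| <= e.
Proof.
move=> ab p0 q0 pq cfg fA gC.
have cau := rs_sum_cauchy ab p0 q0 pq cfg fA gC.
have /choice[t Ht] n := uniform_tagged n ab.
pose s n := rs_sum B f g n.+1 (t n) (t n).
have mesh d : 0 < d -> \forall n \near \oo, forall i, (i < n.+1)%N ->
    t n i.+1 - t n i < d.
  move=> d0; have /cvgrPdist_lt/(_ d d0) : (b - a) * n.+1%:R^-1 @[n --> \oo] --> (0 : R).
    by rewrite -[0](mulr0 (b - a)); apply: cvgMr; exact: cvg_harmonic.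
  apply: filterS => n; rewrite sub0r normrN => H i ilt.
  exact: le_lt_trans ((Ht n).2 i ilt) (le_lt_trans (ler_norm _) H).
have scau : cauchy_ex (s @ \oo).
  move=> e e0; have e20 : 0 < e / 2 by rewrite divr_gt0.
  have [d d0 Hd] := cau _ e20.
  have [N _ HN] := mesh d d0.
  exists (s N); suff: \forall n \near \oo, ball (s N) e (s n) by [].
  near=> n; rewrite -ball_normE /=.
  have dn : forall i, (i < n.+1)%N -> t n i.+1 - t n i < d.
    by near: n; exact: mesh.
  rewrite (le_lt_trans (Hd _ _ _ _ _ _ (Ht N).1 (Ht n).1 _ _))//.
    exact: (HN N (leqnn N)).
  by rewrite ltr_pdivrMr// ltr_pMr// ltr1n.
have /cauchy_cvgP/cvg_ex[I sI] : cauchy (s @ \oo) by exact: cauchy_exP.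
exists I => e e0; have e20 : 0 < e / 2 by rewrite divr_gt0.
have [d d0 Hd] := cau _ e20; exists d => // n xi r tr rd.
have [N [HI HN]] : exists N, `|I - s N| < e / 2 /\
    forall i, (i < N.+1)%N -> t N i.+1 - t N i < d.
  near \oo => N; exists N; split.
    by near: N; have /cvgrPdist_lt/(_ _ e20) := sI.
  by near: N; exact: mesh.
rewrite -(subrK (s N) I) -addrA (splitr e) (le_trans (ler_normD _ _))//.
by rewrite lerD ?(ltW HI)// Hd//; exact: (Ht N).1.
Unshelve. all: by end_near. Qed.

(** For [O] and [C] positive this is [young_bound] with base tag [a]. Otherwise [f] or [g] is
    constant on [[a, b]] and the error vanishes. *)
Lemma rs_sum_bound f g a b p q A C O : a <= b ->
  1 < p -> 1 < q -> 1 < p^-1 + q^-1 -> 0 <= O -> O <= A `^ p^-1 ->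
  (forall x y, a <= x <= b -> a <= y <= b -> `|f x - f y| <= O) ->
  (forall u n, chain a b u -> varsum p f u n <= A) ->
  (forall u n, chain a b u -> varsum q g u n <= C) ->
  forall n xi t, tagged_chain a b n xi t ->
  `|rs_sum B f g n xi t - B (f a) (g b - g a)| <=
    young_const p q * A `^ (1 - q^-1) * O `^ (1 + p / q - p) * C `^ q^-1.
Proof.
move=> ab p1 q1 pq O0 OA fO fA gC n xi t tt.
have p0 : 0 < p by exact: lt_trans p1.
have q0 : 0 < q by exact: lt_trans q1.
have [u cu uE] := chain_tags ab tt.
have [ct t0 tn _] := tt.
have chain_a : chain a b (fun=> a) by split=> // _; rewrite lexx ab.
have A0 : 0 <= A by exact: le_trans (varsum_ge0 _ _ _ _) (fA _ 0%N chain_a).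
have C0 : 0 <= C by exact: le_trans (varsum_ge0 _ _ _ _) (gC _ 0%N chain_a).
have := tag_error_rs_sum BDl BDr f g n a xi t; rewrite tn t0 => <-.
rewrite (@eq_tag_error R X Y V B n _ (f \o u)); last by move=> i /uE/= ->.
have K0 : 0 <= young_const p q.
  rewrite /young_const mulr_ge0 ?powR_ge0// addr_ge0//.
    by rewrite invr_ge0 subr_ge0 invf_le1// ltW.
  by rewrite divr_ge0 ?powR_ge0// subr_ge0 ltW.
have trivial_bound : (forall x y x' y', a <= x <= b -> a <= x' <= b ->
    a <= y <= b -> a <= y' <= b -> `|f x - f x'| * `|g y - g y'| <= 0) ->
    `|tag_error B n (f \o u) (g \o t)| <= young_const p q * A `^ (1 - q^-1) *
      O `^ (1 + p / q - p) * C `^ q^-1.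
  move=> fg0; apply: (@le_trans _ _ 0); last first.
    by do 3 rewrite mulr_ge0 ?powR_ge0//.
  have := @tag_error_le R X Y V B BDl BDr normB f g a b (fun=> 0).
  move=> /(_ _ n u t cu ct); rewrite big1//; apply=> m u' v' cu' cv'.
  by exists 0%N => //; apply: fg0; [exact: cu'.2|exact: cu'.2|exact: cv'.2|exact: cv'.2].
have [zO|nzO] := eqVneq O 0.
  apply: trivial_bound => x y x' y' hx hx' _ _.
  have := fO _ _ hx hx'; rewrite zO normr_le0 => /eqP->.
  by rewrite normr0 mul0r.
have [zC|nzC] := eqVneq C 0.
  apply: trivial_bound => x y x' y' _ _ hy hy'.
  have := dist_le_varsum q0 gC hy hy'.
  rewrite zC powR0 ?invr_eq0 ?(gt_eqF q0)// normr_le0 => /eqP->.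
  by rewrite normr0 mulr0.
apply: (@young_bound R X Y V B BDl BDr normB f g a b p q A C O) => //.
- by rewrite lt0r nzO.
- rewrite -[leRHS]powRr1// -(mulVf (lt0r_neq0 p0)) powRrM.
  by apply: ge0_ler_powR; rewrite ?nnegrE ?powR_ge0// ltW.
- by rewrite lt0r nzC.
Qed.

End existence.

(** * From lists of points to sequences *)

Section conversions.
Context {R : realType}.
Implicit Types (a b p c x : R) (s : seq R).

Lemma pvariation_sum_rcons {W : normedModType R} p (h : R -> W) c s x :
  pvariation_sum p h c (rcons s x) =
  pvariation_sum p h c s + `|h x - h (last c s)| `^ p.
Proof.
rewrite /pvariation_sum size_rcons big_ord_recr/= nth_rcons ltnn eqxx.
congr (_ + `|_ - h _| `^ p).
  by apply: eq_bigr => i _; rewrite -rcons_cons !nth_rcons/= ltn_ord leqW// ltnW.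
by rewrite -rcons_cons nth_rcons/= ltnSn -[size s]/((size (c :: s)).-1) nth_last.
Qed.

(** Repeated points contribute [0 ^ p = 0] and are dropped, which leaves a strictly increasing list
    with endpoints [u 0] and [u n]. *)
Lemma varsum_le_pvariation {W : normedModType R} p (h : R -> W) a b u n :
  p != 0 -> chain a b u -> ((varsum p h u n)%:E <= pvariation p h a b)%E.
Proof.
move=> p0 [um uab].
have [s [su sn <-]] : exists s, [/\ path <%R (u 0%N) s, last (u 0%N) s = u n &
    pvariation_sum p h (u 0%N) s = varsum p h u n].
  elim: n => [|n [s [su sn sv]]].
    by exists [::]; rewrite /pvariation_sum /varsum !big_ord0.
  rewrite /varsum big_ord_recr/= -/(varsum p h u n).
  have := um _ _ (leqnSn n); rewrite le_eqVlt => /predU1P[un|un].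
    by exists s; rewrite sn -un subrr normr0 powR0// addr0.
  exists (rcons s (u n.+1)); split; last by rewrite pvariation_sum_rcons sv sn.
    by rewrite rcons_path su/= sn.
  by rewrite last_rcons.
apply: ereal_sup_ubound; exists (u 0%N), (u n), s; split=> //.
- by have /andP[] := uab 0%N.
- by split=> //; rewrite sn.
- by have /andP[] := uab n.
Qed.

(** The default value [b] keeps the sequence monotone past the last point. *)
Lemma tagged_partition_chain a b (P : tagged_partition a b) : a <= b ->
  tagged_chain a b (size (tp_pts P)) (tp_tag P) (nth b (a :: tp_pts P)).
Proof.
case: P => s xi Hs Hxi /= ab.
have mem n : a <= nth b (a :: s) n <= b.
  have [ns|ns] := ltnP n (size s).+1; last by rewrite nth_default// ab lexx.
  by rewrite itv_partition_nth_le// itv_partition_nth_ge.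
split=> //.
- split=> // m n mn; have [ns|ns] := ltnP n (size s).+1; last first.
    by rewrite [leRHS]nth_default//; have /andP[] := mem m.
  have srt : sorted <=%R (a :: s)
    by have [h _] := Hs; apply: sub_path h => x y; exact: ltW.
  apply: (sorted_leq_nth le_trans lexx b srt) => //; rewrite inE//=.
  exact: leq_ltn_trans mn ns.
- by rewrite (itv_partition_nth_size b Hs).
- by move=> i ilt; have := Hxi i ilt; rewrite !(set_nth_default b a)//= ltnS ltnW.
Qed.

Lemma tagged_partition_mesh a b (P : tagged_partition a b) i :
  (i < size (tp_pts P))%N ->
  nth b (a :: tp_pts P) i.+1 - nth b (a :: tp_pts P) i <= tp_mesh P.
Proof.
move=> ilt; rewrite !(set_nth_default a b)//=; last by rewrite ltnS ltnW.
exact: (le_bigmax _ (fun i : 'I__ =>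
  nth a (a :: tp_pts P) i.+1 - nth a (a :: tp_pts P) i) (Ordinal ilt)).
Qed.

Lemma RS_sumE {E V : normedModType R} (f : R -> clin E V) (g : R -> E) a b
    (P : tagged_partition a b) :
  RS_sum f g P = rs_sum (@clin_fun R E V) f g (size (tp_pts P)) (tp_tag P)
    (nth b (a :: tp_pts P)).
Proof.
apply: eq_bigr => i _; have ilt := ltn_ord i.
by rewrite !(set_nth_default a b) //= ?ltnS// ltnW.
Qed.

End conversions.

(** * Finite norms and passage to the limit in the bound *)

Lemma fine_tagged_chain {R : realType} (a b d : R) : a <= b -> 0 < d ->
  exists n t, tagged_chain a b n t t /\
    forall i, (i < n)%N -> t i.+1 - t i < d.
Proof.
move=> ab d0; have bd0 : 0 <= (b - a) / d by rewrite divr_ge0 ?subr_ge0// ltW.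
have [t [tt td]] := uniform_tagged (Num.truncn ((b - a) / d)) ab.
exists (Num.truncn ((b - a) / d)).+1, t; split=> // i /td /le_lt_trans; apply.
rewrite ltr_pdivrMr ?ltr0n// mulrC -ltr_pdivrMr//.
by have /andP[] := truncn_itv bd0.
Qed.

Theorem corollary1 (R : realType) (p q : R) (hp : 1 < p) (hq : 1 < q)
    (hpq : 1 < p^-1 + q^-1) :
  exists C : R,
    forall (E V : completeNormedModType R) (a b : R)
           (f : R -> clin E V) (g : R -> E),
      a < b ->
      (forall x : R, x \in `[a, b] ->
         ~ (~ continuous_in_at a b f x /\ ~ continuous_in_at a b g x)) ->
      finite_pvariation p f a b ->
      finite_pvariation q g a b ->
      exists I : V,
        is_RS_integral f g a b I /\
        (`|I - f a (g b - g a)|%:E <=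
           C%:E * pvar_norm p f a b `^ (p - p / q)
                * osc_norm f a b `^ (1 + p / q - p)
                * pvar_norm q g a b)%E.
Proof.
exists (young_const p q) => E V a b f g ab cfg ffin gfin.
have p0 : 0 < p by exact: lt_trans hp.
have q0 : 0 < q by exact: lt_trans hq.
have leab := ltW ab.
have varb (W : normedModType R) (h : R -> W) r : 0 < r ->
    finite_pvariation r h a b -> exists2 A, pvariation r h a b = A%:E &
    forall u n, chain a b u -> varsum r h u n <= A.
  move=> r0 hfin.
  have hle u n : chain a b u -> ((varsum r h u n)%:E <= pvariation r h a b)%E.
    by apply: varsum_le_pvariation; rewrite gt_eqF.
  have ca : chain a b (fun=> a) by split=> // _; rewrite lexx leab.
  have vfin : pvariation r h a b \is a fin_num.
    by rewrite ge0_fin_numE// (le_trans _ (hle _ 0%N ca))// lee_fin varsum_ge0.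
  exists (fine (pvariation r h a b)); first by rewrite fineK.
  by move=> u n cu; rewrite -lee_fin fineK// hle.
have [A AE fA] := varb _ f p p0 ffin.
have [C CE gC] := varb _ g q q0 gfin.
have fosc := dist_le_varsum p0 fA.
(* Increments of [f] are at most [A ^ (1/p)], so the oscillation is a real number [w] below that
   value. *)
have [w wE [w0 wA fw]] : exists2 w, osc_norm f a b = w%:E &
    [/\ 0 <= w, w <= A `^ p^-1 &
        forall x y, a <= x <= b -> a <= y <= b -> `|f x - f y| <= w].
  have ole : (osc_norm f a b <= (A `^ p^-1)%:E)%E.
    apply: ge_ereal_sup => _ [x [y [ax xy yb ->]]]; rewrite lee_fin; apply: fosc.
      by rewrite ax (le_trans (ltW xy)).
    by rewrite yb (le_trans ax (ltW xy)).
  have oge x y : a <= x -> x < y -> y <= b -> (`|f x - f y|%:E <= osc_norm f a b)%E.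
    by move=> ax xy yb; apply: ereal_sup_ubound; exists x, y.
  have o0 : (0 <= osc_norm f a b)%E.
    by rewrite (le_trans _ (oge a b _ _ _))// lee_fin.
  have ofin : osc_norm f a b \is a fin_num.
    by rewrite ge0_fin_numE// (le_lt_trans ole)// ltry.
  exists (fine (osc_norm f a b)); first by rewrite fineK.
  split; [exact: fine_ge0|by rewrite -lee_fin fineK|].
  move=> x y /andP[ax xb] /andP[ay yb]; rewrite -lee_fin fineK//.
  have [xy|yx|->] := ltgtP x y; first exact: oge.
    by rewrite distrC; exact: oge.
  by rewrite subrr normr0.
pose B := @clin_fun R E V.
have BDl x x' y : B (x + x') y = B x y + B x' y by [].
have BDr x y y' : B x (y + y') = B x y + B x y' by exact: linearD.
have normB x y : `|B x y| <= `|x| * `|y| by exact: ler_opnorm.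
have [I HI] := rs_integral_exists BDl BDr normB leab p0 q0 hpq cfg fA gC.
exists I; split.
  move=> P P0; apply/cvgrPdist_le => e e0; have [d d0 Hd] := HI e e0.
  move/cvgrPdist_lt : P0 => /(_ d d0); apply: filterS => n.
  rewrite sub0r normrN => mesh; rewrite RS_sumE; apply: Hd.
    exact: tagged_partition_chain.
  move=> i /tagged_partition_mesh /le_lt_trans; apply.
  exact: le_lt_trans (ler_norm _) mesh.
rewrite /pvar_norm AE CE wE !poweR_EFin -!EFinM lee_fin -powRrM.
have -> : p^-1 * (p - p / q) = 1 - q^-1.
  by rewrite mulrBr mulVf ?gt_eqF// mulrA mulVf ?gt_eqF// mul1r.
(* The bound is uniform over Riemann sums, so a single one within [e] of [I] suffices. *)
apply/ler_addgt0Pr => e e0; have [d d0 Hd] := HI e e0.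
have [n [t [tt td]]] := fine_tagged_chain leab d0.
have := rs_sum_bound BDl BDr normB leab hp hq hpq w0 wA fw fA gC tt.
have := Hd n t t tt td.
set S := rs_sum _ _ _ _ _ _ => IS SB.
rewrite -(subrKA S) [leRHS]addrC (le_trans (ler_normD _ _))//.
exact: lerD.
Qed.
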